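(* Let $(\mathfrak{g},\bullet)$ be a left Leibniz algebra and define symmetric bilinear forms on $\mathfrak{g}$ by $$B(u,v)=\mathrm{tr}(\mathrm{L}_u\circ\mathrm{L}_v),\qquad K(u,v)=-\tfrac12\left(\mathrm{tr}(\mathrm{L}_u\circ\mathrm{R}_v)+\mathrm{tr}(\mathrm{L}_v\circ\mathrm{R}_u)\right).$$ Then $B$ and $K$ are bi-invariant and hence $\ker B$ and $\ker K$ contain $\mathrm{Leib}(\mathfrak{g})$. Moreover, for any $u,v\in\mathfrak{g}$, $$K(u,v)=\widehat{K}(\pi(u),\pi(v)),$$ where $\pi:\mathfrak{g}\to\mathfrak{g}/\mathrm{Leib}(\mathfrak{g})$ is the canonical projection and $\widehat{K}$ is the Killing form of the Lie algebra $\mathfrak{g}/\mathrm{Leib}(\mathfrak{g})$. Furthermore, $\ker K$ is a solvable ideal of $\mathfrak{g}$ and hence it is contained in the radical of $\mathfrak{g}$ (the largest solvable ideal of $\mathfrak{g}$).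
   Context: Algebras are real and finite dimensional. For $u\in\mathfrak{g}$, $\mathrm{L}_u(v)=u\bullet v$ and $\mathrm{R}_u(v)=v\bullet u$. $(\mathfrak{g},\bullet)$ is a left Leibniz algebra if $u\bullet(v\bullet w)=(u\bullet v)\bullet w+v\bullet(u\bullet w)$ for all $u,v,w$. $\mathrm{Leib}(\mathfrak{g})=\mathrm{span}\{u\bullet v+v\bullet u: u,v\in\mathfrak{g}\}$ is a (two-sided) ideal and the quotient $\mathfrak{g}/\mathrm{Leib}(\mathfrak{g})$ is a Lie algebra. A symmetric bilinear form $S$ is bi-invariant if it is $\mathrm{L}$-invariant ($S(u\bullet v,w)+S(v,u\bullet w)=0$), $\mathrm{R}$-invariant ($S(u\bullet v,w)+S(u,w\bullet v)=0$) and associative ($S(u\bullet v,w)=S(u,v\bullet w)$), for all $u,v,w$. $\ker S=\{x: S(x,\cdot)=0\}$. Solvable means that the derived series $\mathfrak{a}^{(1)}=\mathfrak{a}$, $\mathfrak{a}^{(n+1)}=\mathfrak{a}^{(n)}\bullet\mathfrak{a}^{(n)}$ reaches $\{0\}$, where $F\bullet G$ denotes the span of the products $u\bullet v$, $u\in F$, $v\in G$. *)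

(* Defs.v *)
From HB Require Import structures.
From mathcomp Require Import all_boot all_order all_algebra.
From mathcomp Require Import boolp classical_sets reals.

Set Implicit Arguments.
Unset Strict Implicit.
Unset Printing Implicit Defensive.

Import Order.TTheory GRing.Theory Num.Theory passmx.
Local Open Scope ring_scope.
Local Open Scope quotient_scope.

Section LinearSpan.
Variables (F : fieldType) (V : vectType F).
Implicit Types (A : set V) (U : {vspace V}).

(* The subspace of finite linear combinations of elements of A. The library
   only has the span <<s>> of a finite sequence s; [memv_lspan] shows that
   [xget] finds a subspace here, so that the default value is never used. *)
Definition lspan A : {vspace V} :=
  xget 0%VS [set U : {vspace V} | forall x,
    x \in U <-> exists2 s : seq V, (forall y, y \in s -> A y) & x \in <<s>>%VS].

Lemma memv_lspan A x :
  x \in lspan A <->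
  exists2 s : seq V, (forall y, y \in s -> A y) & x \in <<s>>%VS.
Proof.
rewrite /lspan; move: x; apply: (@xgetPex _ 0%VS
  [set U : {vspace V} | forall x, x \in U <-> exists2 s : seq V,
     (forall y, y \in s -> A y) & x \in <<s>>%VS]).
pose P n := `[< exists2 s : seq V, (forall y, y \in s -> A y)
                                   & \dim <<s>>%VS = n >].
have exP : exists n, P n.
  exists 0%N; apply/asboolP; exists [::] => //.
  by rewrite span_nil dimv0.
have ubP n : P n -> (n <= \dim {:V})%N.
  by move=> /asboolP[s _ <-]; rewrite dimvS ?subvf.
case: (ex_maxnP exP ubP) => n /asboolP[s sA <-] smax.
exists <<s>>%VS => x; split; first by exists s.
case=> t tA xt; have st : (<<s>> <= <<s ++ t>>)%VS.
  by rewrite span_cat addvSl.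
have /eqP -> : (<<s>> == <<s ++ t>>)%VS.
  rewrite -(dimv_leqif_eq st) eqn_leq dimvS //=.
  apply: smax; apply/asboolP; exists (s ++ t) => // y.
  by rewrite mem_cat => /orP[/sA|/tA].
by rewrite span_cat; move: x xt; apply/subvP; rewrite addvSr.
Qed.

Lemma mem_lspan A x : A x -> x \in lspan A.
Proof.
move=> Ax; apply/memv_lspan; exists [:: x]; last by rewrite memv_span ?inE.
by move=> y; rewrite inE => /eqP ->.
Qed.

Lemma lspan_subv A U : (forall x, A x -> x \in U) -> (lspan A <= U)%VS.
Proof.
move=> AU; apply/subvP=> x /memv_lspan[s sA]; move: x; apply/subvP.
by apply/span_subvP => y /sA/AU.
Qed.

End LinearSpan.

(* By [lftrace_basis] the choice of basis is immaterial. *)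
Definition lftrace (F : fieldType) (V : vectType F) (f : 'End(V)) : F :=
  \tr (mxof (vbasis {:V}) (vbasis {:V}) f).

Section Trace.
Variables (F : fieldType) (V : vectType F).

Lemma lftrace_linear : scalar (@lftrace F V).
Proof. by move=> a f h; rewrite /lftrace !linearP. Qed.

HB.instance Definition _ :=
  GRing.isLinear.Build F 'End(V) F *%R (@lftrace F V) lftrace_linear.

Lemma lftraceC (f h : 'End(V)) :
  lftrace (f \o h)%VF = lftrace (h \o f)%VF.
Proof. by rewrite /lftrace !(mxof_comp _ _ (vbasisP _)) mxtrace_mulC. Qed.

Lemma lftrace_basis (e : (\dim {:V}).-tuple V) (f : 'End(V)) :
  basis_of {:V} e -> lftrace f = \tr (mxof e e f).
Proof.
move=> eB; have bB := vbasisP {:V}; set b := vbasis {:V} in bB.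
rewrite -[f in RHS]comp_lfun1r (mxof_comp e e bB) mxtrace_mulC.
by rewrite -mxof_comp // comp_lfun1l.
Qed.

End Trace.

Definition quotv (F : fieldType) (V : vectType F) (U : {vspace V}) : Type :=
  Quotient.quot (pred_of_vspace U).

Section QuotientSpace.
Variables (F : fieldType) (V : vectType F) (U : {vspace V}).
Implicit Types (x y : quotv U).

HB.instance Definition _ := GRing.Zmodule.on (quotv U).
HB.instance Definition _ := ZmodQuotient.on (quotv U).

Lemma quotv_eq (u v : V) : (\pi_(quotv U) u == \pi_(quotv U) v) = (u - v \in U).
Proof. by rewrite -Quotient.idealrBE. Qed.

Lemma reprB_quotv (u : V) : u - repr (\pi_(quotv U) u) \in U.
Proof. by rewrite -quotv_eq reprK. Qed.

Definition quotv_scale (a : F) x : quotv U := \pi_(quotv U) (a *: repr x).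

Lemma pi_scale a (u : V) :
  quotv_scale a (\pi_(quotv U) u) = \pi_(quotv U) (a *: u).
Proof.
apply/eqP; rewrite eq_sym /quotv_scale quotv_eq.
by rewrite -scalerBr memvZ ?reprB_quotv.
Qed.

Fact quotv_scaleA a b x :
  quotv_scale a (quotv_scale b x) = quotv_scale (a * b) x.
Proof. by rewrite -[x]reprK (pi_scale b) !(pi_scale _ _) scalerA. Qed.

Fact quotv_scale1 : left_id 1 quotv_scale.
Proof. by move=> x; rewrite -[x]reprK pi_scale scale1r. Qed.

Fact quotv_scaleDr : right_distributive quotv_scale +%R.
Proof.
move=> a x y; rewrite -[x]reprK -[y]reprK -raddfD !pi_scale scalerDr.
by rewrite raddfD.
Qed.

Fact quotv_scaleDl x : {morph quotv_scale^~ x : a b / a + b}.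
Proof. by move=> a b; rewrite -[x]reprK !pi_scale scalerDl raddfD. Qed.

HB.instance Definition _ := GRing.Zmodule_isLmodule.Build F (quotv U)
  quotv_scaleA quotv_scale1 quotv_scaleDr quotv_scaleDl.

Lemma pi_quotv_linear : linear (\pi_(quotv U) : V -> quotv U).
Proof. by move=> a u v; rewrite raddfD; congr (_ + _); apply/esym/pi_scale. Qed.

Let W := (U^C)%VS.
Let p := daddv_pi W U.

Let disjWU : (W :&: U = 0)%VS. Proof. by rewrite capvC capv_compl. Qed.

Let pE u : p u = 0 <-> u \in U.
Proof.
have uE : u = p u + daddv_pi U W u.
  by rewrite daddv_pi_add // addvC addv_complf memvf.
split=> [pu0|uU]; first by rewrite uE pu0 add0r memv_pi.
move: uE; rewrite (@daddv_pi_id _ _ U W) ?(capvC U) // => /(canLR (addrK _)).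
by rewrite subrr.
Qed.

Let pKB u : u - p u \in U.
Proof. by apply/pE; rewrite linearB /= /p daddv_pi_proj // subrr. Qed.

Let h x : 'rV[F]_(\dim W) := \row_i coord (vbasis W) i (p (repr x)).

Let h_pi u : h (\pi_(quotv U) u) = \row_i coord (vbasis W) i (p u).
Proof.
suff -> : p u = p (repr (\pi_(quotv U) u)) by [].
by apply/eqP; rewrite -subr_eq0 -linearB; apply/eqP/pE/reprB_quotv.
Qed.

Fact quotv_vect : Vector.axiom (\dim W) (quotv U).
Proof.
exists h => [a x y|].
  rewrite -[x]reprK -[y]reprK -pi_quotv_linear !h_pi; apply/rowP => i.
  by rewrite !mxE !linearP.
exists (fun r : 'rV_(\dim W) =>
          \pi_(quotv U) (\sum_i r 0 i *: (vbasis W)`_i)) => [x|r].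
  rewrite -[x]reprK h_pi; apply/eqP; rewrite eq_sym quotv_eq.
  under eq_bigr do rewrite mxE.
  by rewrite -coord_vbasis ?memv_pi // pKB.
rewrite h_pi /p daddv_pi_id //; last first.
  apply: memv_suml => i _.
  by rewrite memvZ // vbasis_mem // mem_nth ?size_tuple.
apply/rowP => i; rewrite mxE coord_sum_free //.
exact/basis_free/vbasisP.
Qed.

HB.instance Definition _ := Lmodule_hasFinDim.Build F (quotv U) quotv_vect.

End QuotientSpace.

HB.mixin Record isLeftLeibniz (F : fieldType) g of Vector F g := {
  bul : {bilinear g -> g -> g};
  bul_leibniz : forall u v w,
    bul u (bul v w) = bul (bul u v) w + bul v (bul u w)
}.

#[short(type="leftLeibnizType")]
HB.structure Definition LeftLeibniz (F : fieldType) :=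
  {g of isLeftLeibniz F g & Vector F g}.

Notation "u • v" := (bul u v) (at level 40, left associativity) : ring_scope.

(* For an alternating product the left Leibniz identity is Jacobi's. *)
HB.mixin Record LeftLeibniz_isLie (F : fieldType) g of LeftLeibniz F g := {
  bulxx : forall u : g, u • u = 0
}.

#[short(type="lieType")]
HB.structure Definition Lie (F : fieldType) :=
  {g of LeftLeibniz_isLie F g & LeftLeibniz F g}.

Section LeibnizTheory.
Variables (F : fieldType) (g : leftLeibnizType F).
Implicit Types (u v w : g) (I J U V W : {vspace g}).

Definition Lmul u : 'End(g) := linfun (bul u).
Definition Rmul u : 'End(g) := linfun (applyr bul u).

Lemma LmulE u v : Lmul u v = u • v. Proof. by rewrite lfunE. Qed.
Lemma RmulE u v : Rmul u v = v • u. Proof. by rewrite lfunE. Qed.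

Lemma Lmul_linear : linear Lmul.
Proof.
move=> a u v; apply/lfunP => w.
by rewrite add_lfunE scale_lfunE !LmulE linearPl.
Qed.
HB.instance Definition _ := GRing.isLinear.Build F g 'End(g) *:%R Lmul Lmul_linear.

Lemma Rmul_linear : linear Rmul.
Proof.
move=> a u v; apply/lfunP => w.
by rewrite add_lfunE scale_lfunE !RmulE linearPr.
Qed.
HB.instance Definition _ := GRing.isLinear.Build F g 'End(g) *:%R Rmul Rmul_linear.

Definition Leib : {vspace g} :=
  lspan [set x : g | exists u v, x = u • v + v • u].

Definition idealv I : Prop :=
  forall x u, x \in I -> u • x \in I /\ x • u \in I.

Definition bulv U V : {vspace g} :=
  lspan [set x : g | exists u v, [/\ u \in U, v \in V & x = u • v]].

(* Indexed from 0: [derived U n] is the (n+1)-st term of the derived series. *)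
Fixpoint derived U (n : nat) : {vspace g} :=
  if n is m.+1 then bulv (derived U m) (derived U m) else U.

Definition solvablev U : Prop := exists n, derived U n = 0%VS.

Definition largest_solvable_ideal U : Prop :=
  [/\ idealv U, solvablev U &
      forall I, idealv I -> solvablev I -> (I <= U)%VS].

(* [radicalP] below: the default value of [xget] is never used. *)
Definition radical : {vspace g} := xget 0%VS [set U | largest_solvable_ideal U].

Lemma memv_bulv U V u v : u \in U -> v \in V -> u • v \in bulv U V.
Proof. by move=> uU vV; apply: mem_lspan; exists u, v. Qed.

Lemma bulv_subv U V W :
  (forall u v, u \in U -> v \in V -> u • v \in W) -> (bulv U V <= W)%VS.
Proof. by move=> UVW; apply: lspan_subv => x [u [v [uU vV ->]]]; apply: UVW. Qed.

Lemma bulvS U U' V V' :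
  (U <= U')%VS -> (V <= V')%VS -> (bulv U V <= bulv U' V')%VS.
Proof.
move=> /subvP UU' /subvP VV'; apply: bulv_subv => u v /UU' uU /VV' vV.
exact: memv_bulv.
Qed.

Lemma derivedS U V n : (U <= V)%VS -> (derived U n <= derived V n)%VS.
Proof. by move=> UV; elim: n => //= n IHn; apply: bulvS. Qed.

Lemma derivedD U m n : derived U (m + n) = derived (derived U m) n.
Proof. by elim: n => [|n IHn]; rewrite ?addn0 // addnS /= IHn. Qed.

Lemma ideal0 : idealv 0%VS.
Proof.
by move=> x u /[!memv0] /eqP ->; rewrite linear0r linear0l eqxx.
Qed.

Lemma solvable0 : solvablev 0%VS. Proof. by exists 0%N. Qed.

Lemma idealD I J : idealv I -> idealv J -> idealv (I + J)%VS.
Proof.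
move=> idI idJ _ u /memv_addP[x xI [y yJ ->]].
have [uxI xuI] := idI x u xI; have [uyJ yuJ] := idJ y u yJ.
by rewrite linearDr linearDl !memv_add.
Qed.

Lemma derived_addv I J n : idealv J -> (derived (I + J) n <= derived I n + J)%VS.
Proof.
move=> idJ; elim: n => //= n /subvP IHn.
apply: bulv_subv => _ _ /IHn/memv_addP[a aI [x xJ ->]] /IHn/memv_addP[b bI [y yJ ->]].
rewrite linearDl linearDr -addrA memv_add ?memv_bulv //.
by rewrite memvD ?(idJ y a yJ).1 // linearDr memvD ?(idJ x _ xJ).2.
Qed.

Lemma solvableD I J : solvablev I -> solvablev J -> idealv J -> solvablev (I + J)%VS.
Proof.
move=> [m Im] [n Jn] idJ; exists (m + n)%N; apply/eqP; rewrite -subv0.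
rewrite derivedD -Jn derivedS //.
by rewrite (subv_trans (derived_addv _ _ idJ)) // Im add0v.
Qed.

Lemma radicalP : largest_solvable_ideal radical.
Proof.
apply: (@xgetPex _ 0%VS [set U | largest_solvable_ideal U]).
pose P n := `[< exists U, [/\ idealv U, solvablev U & \dim U = n] >].
have exP : exists n, P n.
  by exists 0%N; apply/asboolP; exists 0%VS; split;
    [exact: ideal0 | exact: solvable0 | rewrite dimv0].
have ubP n : P n -> (n <= \dim {:g})%N.
  by move=> /asboolP[U [_ _ <-]]; rewrite dimvS ?subvf.
case: (ex_maxnP exP ubP) => n /asboolP[U [idU solU <-]] Umax.
exists U; split => // I idI solI.
have UI : (U <= U + I)%VS by rewrite addvSl.
suff /eqP -> : U == (U + I)%VS by rewrite addvSr.
rewrite -(dimv_leqif_eq UI) eqn_leq dimvS //=.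
apply: Umax; apply/asboolP; exists (U + I)%VS.
by split=> //; [exact: idealD | exact: solvableD].
Qed.

Lemma memv_Leib u v : u • v + v • u \in Leib.
Proof. by apply: mem_lspan; exists u, v. Qed.

Lemma bulA u v w : (u • v) • w = u • (v • w) - v • (u • w).
Proof. by rewrite bul_leibniz addrK. Qed.

Lemma bul_Leib x u : x \in Leib -> x • u = 0.
Proof.
move=> xL; rewrite -RmulE; apply/eqP; rewrite -memv_ker; move: x xL.
apply/subvP/lspan_subv => _ [v [w ->]]; rewrite memv_ker RmulE linearDl.
by rewrite !bulA addrA addrNK subrr.
Qed.

Lemma Leib_ideal : idealv Leib.
Proof.
move=> x u xL; split; last by rewrite (bul_Leib _ xL) mem0v.
rewrite -LmulE memv_preim; move: x xL.
apply/subvP/lspan_subv => _ [v [w ->]]; rewrite -memv_preim LmulE linearDr.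
rewrite (bul_leibniz u v w) (bul_leibniz u w v) addrACA.
rewrite [v • (u • w) + _]addrC addrACA.
rewrite [X in _ + X]addrC; apply: memvD; last exact: memv_Leib.
exact: memv_Leib.
Qed.

Definition lie_quot : Type := quotv Leib.

HB.instance Definition _ := Vector.on lie_quot.
HB.instance Definition _ := ZmodQuotient.on lie_quot.

Definition lie_proj (u : g) : lie_quot := \pi_lie_quot u.

Definition lie_bul (x y : lie_quot) : lie_quot := lie_proj (repr x • repr y).

Lemma lie_projK x : lie_proj (repr x) = x.
Proof. exact: reprK. Qed.

Lemma lie_proj_linear : linear lie_proj.
Proof. exact: pi_quotv_linear. Qed.
HB.instance Definition _ :=
  GRing.isLinear.Build F g lie_quot *:%R lie_proj lie_proj_linear.

Lemma lie_proj_eq0 u : (lie_proj u == 0) = (u \in Leib).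
Proof. by rewrite -(linear0 lie_proj) [LHS]quotv_eq subr0. Qed.

Lemma lie_bulE u v : lie_bul (lie_proj u) (lie_proj v) = lie_proj (u • v).
Proof.
have reprE w : exists2 x, x \in Leib & repr (lie_proj w) = w + x.
  exists (repr (lie_proj w) - w); last by rewrite addrC subrK.
  by rewrite -opprB memvN; apply: reprB_quotv.
rewrite /lie_bul; have [x xL ->] := reprE u; have [y yL ->] := reprE v.
apply/eqP; rewrite -subr_eq0 -linearB lie_proj_eq0 linearDl.
rewrite (bul_Leib _ xL) addr0 linearDr addrC addKr.
by case: (Leib_ideal u yL).
Qed.

Fact lie_bul_bilinear : bilinear_for *:%R *:%R lie_bul.
Proof.
split=> [y|x] a.
  move=> x z; rewrite -[x]lie_projK -[y]lie_projK -[z]lie_projK.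
  by rewrite -lie_proj_linear !lie_bulE linearPl lie_proj_linear.
move=> y z; rewrite -[x]lie_projK -[y]lie_projK -[z]lie_projK.
by rewrite -lie_proj_linear !lie_bulE linearPr lie_proj_linear.
Qed.

HB.instance Definition _ := bilinear_isBilinear.Build F lie_quot lie_quot
  lie_quot *:%R *:%R lie_bul lie_bul_bilinear.

Fact lie_bul_leibniz (x y z : lie_quot) :
  lie_bul x (lie_bul y z) = lie_bul (lie_bul x y) z + lie_bul y (lie_bul x z).
Proof.
rewrite -[x]lie_projK -[y]lie_projK -[z]lie_projK !lie_bulE.
by rewrite bul_leibniz linearD.
Qed.

HB.instance Definition _ := isLeftLeibniz.Build F lie_quot lie_bul_leibniz.

Lemma lie_projM : {morph lie_proj : u v / u • v}.
Proof. by move=> u v; apply/esym/lie_bulE. Qed.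

End LeibnizTheory.

Fact lie_bulxx (F : numFieldType) (g : leftLeibnizType F) (x : lie_quot g) :
  x • x = 0.
Proof.
rewrite -[x]lie_projK -lie_projM; apply/eqP; rewrite lie_proj_eq0.
set u := repr x; have two_neq0 : 2%:R != 0 :> F by rewrite pnatr_eq0.
rewrite -[u • u](scalerK two_neq0) memvZ // scaler_nat mulr2n.
exact: memv_Leib.
Qed.

HB.instance Definition _ (F : numFieldType) (g : leftLeibnizType F) :=
  LeftLeibniz_isLie.Build F (lie_quot g) (@lie_bulxx F g).

Section InvariantForms.
Variables (F : fieldType) (g : leftLeibnizType F).
Implicit Types (S : {symmetric g}) (u v w : g).

Definition L_invariant S :=
  forall u v w, S (u • v) w + S v (u • w) = 0.

Definition R_invariant S :=
  forall u v w, S (u • v) w + S u (w • v) = 0.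

Definition associative_form S :=
  forall u v w, S (u • v) w = S u (v • w).

Definition bi_invariant S :=
  [/\ L_invariant S, R_invariant S & associative_form S].

Definition form_ker S : {vspace g} := orthov S fullv.

Lemma mem_form_ker S x : x \in form_ker S <-> forall y, S x y = 0.
Proof.
split=> [/mem_orthovP Sx y|Sx]; first by rewrite Sx ?memvf.
by apply/mem_orthovP => y _.
Qed.

Definition B_form u v : F := lftrace (Lmul u \o Lmul v)%VF.

Definition K_form u v : F :=
  - 2^-1 * (lftrace (Lmul u \o Rmul v)%VF + lftrace (Lmul v \o Rmul u)%VF).

Fact B_bilinear : bilinear_for *%R *%R B_form.
Proof.
split=> [w|w] a u v; rewrite /B_form linearP.
  by rewrite comp_lfunDl -comp_lfunZl linearP.
by rewrite comp_lfunDr -comp_lfunZr linearP.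
Qed.
HB.instance Definition _ :=
  bilinear_isBilinear.Build F g g F *%R *%R B_form B_bilinear.

Fact B_symmetric u v : B_form u v = (-1) ^+ false * idfun (B_form v u).
Proof. by rewrite expr0 mul1r /B_form lftraceC. Qed.
HB.instance Definition _ :=
  isHermitianSesquilinear.Build F g false idfun B_form B_symmetric.

Fact K_bilinear : bilinear_for *%R *%R K_form.
Proof.
split=> [w|w] a u v; rewrite /K_form !linearP.
  rewrite comp_lfunDl comp_lfunDr -comp_lfunZl -comp_lfunZr !linearP.
  by rewrite /= addrACA -mulrDr [LHS]mulrDr mulrCA.
rewrite comp_lfunDl comp_lfunDr -comp_lfunZl -comp_lfunZr !linearP.
by rewrite /= addrACA -mulrDr [LHS]mulrDr mulrCA.
Qed.
HB.instance Definition _ :=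
  bilinear_isBilinear.Build F g g F *%R *%R K_form K_bilinear.

Fact K_symmetric u v : K_form u v = (-1) ^+ false * idfun (K_form v u).
Proof. by rewrite expr0 mul1r /K_form addrC. Qed.
HB.instance Definition _ :=
  isHermitianSesquilinear.Build F g false idfun K_form K_symmetric.

End InvariantForms.

Definition killing_form (F : fieldType) (h : lieType F) (x y : h) : F :=
  lftrace (Lmul x \o Lmul y)%VF.

(* Main.v *)
From HB Require Import structures.
Require Import Defs.
From mathcomp Require Import all_boot all_order all_algebra.
From mathcomp Require Import boolp classical_sets reals.
From mathcomp Require Import complex ring.

(** The form B is a trace form of the representation u |-> L_u, so it is
    bi-invariant by the cyclicity of the trace, and it vanishes on Leib because
    L_x = 0 for x in Leib. The form K is the pullback of the Killing form of the
    Lie algebra g/Leib ([K_form_killing]): modulo maps into Leib, R_v is - L_v,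
    and the part of the trace living on Leib cancels because R_v is zero there.
    Bi-invariance of K, and K = 0 on Leib, are then inherited from g/Leib.
    The kernel of a bi-invariant form is an ideal.

    What remains is that the kernel U of the Killing form of a Lie algebra is
    solvable, i.e. Cartan's criterion ([cartan_solvable]). If J = J J is the
    term at which the derived series of U becomes stationary, the point is
    that L_x is nilpotent for x in J ([trace_form_nilpotent]); Engel's theorem
    ([engel]) then forces J = 0.

    Nilpotency is tested on the complex matrix A of L_x. Classically one pairs A
    with the conjugate of its semisimple part. Here that conjugate is
    replaced by a polynomial D(A) with the eigenvalue a^* wherever A has the
    eigenvalue a, and the Jordan decomposition is replaced by the remark that
    ad (D(A)) is a polynomial in ad A ([conj_replica]). This last fact makes
    tr (A D(A)) a combination of values of the Killing form with one argument in
    U, hence 0; as this trace is the sum of the |a|^2 over the eigenvalues, they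
    all vanish. *)

Set Implicit Arguments.
Unset Strict Implicit.
Unset Printing Implicit Defensive.

Import Order.TTheory GRing.Theory Num.Theory passmx.
Local Open Scope ring_scope.

(** * Interpolation by polynomials to high order *)

Lemma coprimep_prod_XsubC_exp (F : fieldType) (s : seq F) a m n :
  a \notin s -> coprimep (('X - a%:P) ^+ m) (\prod_(b <- s) ('X - b%:P) ^+ n).
Proof.
elim: s => [|b s IHs]; first by rewrite big_nil coprimep1.
rewrite inE negb_or big_cons => /andP[aNb /IHs aNs].
rewrite coprimepMr aNs andbT coprimep_expl // coprimep_expr //.
by rewrite coprimep_XsubC2 // subr_eq0 eq_sym.
Qed.

(** The Chinese remainder theorem for the pairwise coprime powers of the
    X - a: Bezout adds one node at a time. *)
Lemma poly_jet_interpolation (F : fieldType) (s : seq F) (c : F -> F) n :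
  uniq s ->
  exists p : {poly F}, {in s, forall a, ('X - a%:P) ^+ n %| p - (c a)%:P}.
Proof.
elim: s => [_|a s IHs /= /andP[aNs /IHs[p ps]]]; first by exists 0.
pose P := ('X - a%:P) ^+ n; pose Q := \prod_(b <- s) ('X - b%:P) ^+ n.
have /Bezout_eq1_coprimepP[[u v] /= uv1] : coprimep P Q.
  exact: coprimep_prod_XsubC_exp.
(* v * Q is 0 modulo Q and 1 modulo P. *)
exists (p + ((c a)%:P - p) * (v * Q)) => b; rewrite inE => /predU1P[->|bs].
  have -> : p + ((c a)%:P - p) * (v * Q) - (c a)%:P = (p - (c a)%:P) * u * P.
    have -> : v * Q = 1 - u * P by rewrite -uv1 addrAC subrr add0r.
    by ring.
  exact: dvdp_mull.
rewrite addrAC dvdp_add ?ps // dvdp_mull // dvdp_mull //.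
by rewrite /Q (big_rem b) //= dvdp_mulr.
Qed.

Lemma dvdp_prod_XsubC_exp (F : fieldType) (s : seq F) n (p : {poly F}) :
  uniq s -> {in s, forall a, ('X - a%:P) ^+ n %| p} ->
  \prod_(a <- s) ('X - a%:P) ^+ n %| p.
Proof.
elim: s => [_ _|a s IHs /= /andP[aNs us] sp]; first by rewrite big_nil dvd1p.
rewrite big_cons Gauss_dvdp ?coprimep_prod_XsubC_exp // sp ?mem_head //=.
by apply: IHs => // b bs; rewrite sp // inE bs orbT.
Qed.

(** Lets a polynomial with roots r annihilating a matrix be replaced by powers
    of distinct linear factors, to which the two previous lemmas apply. *)
Lemma dvdp_prod_undup (F : fieldType) (r : seq F) :
  \prod_(a <- r) ('X - a%:P) %|
  \prod_(a <- undup r) ('X - a%:P) ^+ size r.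
Proof.
(* The size in the exponent counts the factors, so induct on a list whose
   entries occur among the distinct values of r. *)
have sub (s : seq F) : {subset s <= undup r} ->
   \prod_(a <- s) ('X - a%:P) %| \prod_(a <- undup r) ('X - a%:P) ^+ size s.
  elim: s => [_|a s IHs sr]; first by rewrite big_nil dvd1p.
  rewrite big_cons /=; under [X in _ %| X]eq_bigr do rewrite exprS.
  rewrite big_split dvdp_mul //=; last first.
    by apply: IHs => b bs; rewrite sr // inE bs orbT.
  by rewrite (big_rem a) ?sr ?mem_head //= dvdp_mulr.
by apply: sub => a; rewrite mem_undup.
Qed.

(** * Polynomials in the adjoint action of a matrix *)

Section Ad.
Variables (K : fieldType) (n : nat) (A : 'M[K]_n.+1).
Implicit Types (V W : 'M[K]_n.+1) (p q : {poly K}).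

Definition ad_mx V := A * V - V * A.

Fact ad_mx_linear : linear ad_mx.
Proof.
move=> a V W; rewrite /ad_mx mulrDr mulrDl scalerBr -scalerAr -scalerAl.
by rewrite opprD addrACA.
Qed.
HB.instance Definition _ :=
  GRing.isLinear.Build K 'M[K]_n.+1 'M[K]_n.+1 *:%R ad_mx ad_mx_linear.

(** The value at V of the endomorphism p(ad A). *)
Definition horner_ad p V := \sum_(k < size p) p`_k *: iter k ad_mx V.

Lemma horner_ad_widen p V m : (size p <= m)%N ->
  horner_ad p V = \sum_(k < m) p`_k *: iter k ad_mx V.
Proof.
move=> pm; rewrite /horner_ad.
rewrite (big_ord_widen _ (fun k => p`_k *: iter k ad_mx V) pm).
rewrite big_mkcond; apply: eq_bigr => k _; case: ltnP => // /leq_sizeP->//.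
by rewrite scale0r.
Qed.

Lemma horner_adD p q V :
  horner_ad (p + q) V = horner_ad p V + horner_ad q V.
Proof.
rewrite (horner_ad_widen V (size_polyD p q)).
rewrite (horner_ad_widen V (leq_maxl (size p) (size q))).
rewrite (horner_ad_widen V (leq_maxr (size p) (size q))) -big_split /=.
by apply: eq_bigr => k _; rewrite coefD scalerDl.
Qed.

Lemma horner_adZ a p V : horner_ad (a *: p) V = a *: horner_ad p V.
Proof.
rewrite (horner_ad_widen V (size_scale_leq a p)) scaler_sumr.
by apply: eq_bigr => k _; rewrite coefZ scalerA.
Qed.

Lemma horner_adC a V : horner_ad a%:P V = a *: V.
Proof.
rewrite (horner_ad_widen V (size_polyC_leq1 a)) big_ord1.
by rewrite coefC.
Qed.

Lemma horner_adMX p V : horner_ad (p * 'X) V = horner_ad p (ad_mx V).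
Proof.
have sz : (size (p * 'X)%R <= (size p).+1)%N.
  by rewrite (leq_trans (size_polyMleq _ _)) // size_polyX addn2.
rewrite (horner_ad_widen V sz) big_ord_recl coefMX /= scale0r add0r.
by apply: eq_bigr => k _; rewrite coefMX /= -iterSr.
Qed.

Lemma horner_ad_linear p : linear (horner_ad p).
Proof.
move=> a V W; elim/poly_ind: p V W => [|p c IHp] V W.
  by rewrite /horner_ad size_poly0 !big_ord0 scaler0 addr0.
rewrite !horner_adD !horner_adMX !horner_adC linearP IHp !scalerDr.
by rewrite !scalerA [c * a]mulrC addrACA.
Qed.
HB.instance Definition _ p := GRing.isLinear.Build K 'M[K]_n.+1 'M[K]_n.+1
  *:%R (horner_ad p) (horner_ad_linear p).

Lemma horner_adMXsubC p c V :
  horner_ad (p * ('X - c%:P)) V = horner_ad p (ad_mx V - c *: V).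
Proof.
have -> : p * ('X - c%:P) = p * 'X + (- c) *: p.
  by rewrite mulrBr scaleNr -mul_polyC [p * _%:P]mulrC.
rewrite horner_adD horner_adZ horner_adMX.
by rewrite [RHS]linearB [in RHS]linearZ scaleNr.
Qed.

(** ad A - (a - b) is the difference of the commuting operators
    W |-> (A - a) W and W |-> W (A - b), whose powers i and j kill V. So every
    term of the binomial expansion of its k-th power vanishes at V. *)
Lemma horner_ad_eq0 p a b i j k V : (i + j <= k.+1)%N ->
  (A - a%:M) ^+ i * V = 0 -> V * (A - b%:M) ^+ j = 0 ->
  horner_ad (p * ('X - (a - b)%:P) ^+ k) V = 0.
Proof.
have V0 m W : (A - a%:M) ^+ 0 * W = 0 \/ W * (A - b%:M) ^+ 0 = 0 ->
    horner_ad m W = 0.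
  by rewrite mul1r mulr1 => -[] ->; rewrite linear0.
elim: k i j V => [|k IHk] [|i] [|j] V ijk iV Vj; try by apply: V0; auto.
  by move: ijk; rewrite addSn addnS.
rewrite exprSr mulrA horner_adMXsubC.
have -> : ad_mx V - (a - b) *: V = (A - a%:M) * V - V * (A - b%:M).
  rewrite /ad_mx mulrBl mulrBr [a%:M * V]mul_scalar_mx [V * b%:M]mul_mx_scalar.
  by rewrite scalerBl !opprB addrACA [RHS]addrACA [- (V * A) - _]addrC.
have hA : horner_ad (p * ('X - (a - b)%:P) ^+ k) ((A - a%:M) * V) = 0.
  apply: (IHk i j.+1); first by rewrite addSn in ijk.
    by rewrite mulrA -exprSr.
  by rewrite -mulrA Vj mulr0.
have hB : horner_ad (p * ('X - (a - b)%:P) ^+ k) (V * (A - b%:M)) = 0.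
  apply: (IHk i.+1 j); first by rewrite addnS in ijk.
    by rewrite mulrA iV mul0r.
  by rewrite -mulrA -exprS.
by rewrite linearB /= hA hB subrr.
Qed.

End Ad.

(** * The complex conjugate of a matrix, as a polynomial in it *)

Lemma horner_mx_trig (K : fieldType) n (T : 'M[K]_n.+1) (p : {poly K}) :
  is_trig_mx T ->
  is_trig_mx (horner_mx T p) /\ (forall i, horner_mx T p i i = p.[T i i]).
Proof.
move=> /is_trig_mxP Ttrig; elim/poly_ind: p => [|p c [/is_trig_mxP IHt IHd]].
  rewrite rmorph0; split=> [|i]; first exact: mx0_is_trig.
  by rewrite mxE horner0.
rewrite rmorphD rmorphM /= horner_mx_X horner_mx_C; split=> [|i].
  apply/is_trig_mxP => i j ij; rewrite !mxE big1 => [|k _].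
    by rewrite -val_eqE (ltn_eqF ij) add0r.
  have [kj|jk] := ltnP k j; first by rewrite (Ttrig k) ?mulr0.
  by rewrite (IHt i k) ?mul0r // (leq_trans ij).
rewrite !mxE eqxx hornerMXaddC (bigD1 i) //= big1 ?addr0 ?IHd // => k ki.
have [ltki|ik] := ltnP k i; first by rewrite (Ttrig k) ?mulr0.
by rewrite (IHt i k) ?mul0r // ltn_neqAle ik andbT eq_sym.
Qed.

(** r is the diagonal of a Schur triangulation of A: the eigenvalues, with
    multiplicity. *)
Lemma mxtrace_horner (C : numClosedFieldType) n (A : 'M[C]_n.+1) :
  exists r : seq C, [/\ size r = n.+1,
    horner_mx A (\prod_(a <- r) ('X - a%:P)) = 0 &
    forall p, \tr (horner_mx A p) = \sum_(a <- r) p.[a]].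
Proof.
have [P /unitarymx_unit Pu] := Schur A (ltn0Sn n).
have -> : similar_to P A is_trig_mx = is_trig_mx (P *m A *m invmx P).
  by rewrite -conjumx.
set T := _ *m invmx P => Ttrig.
have hE p : horner_mx A p = invmx P *m horner_mx T p *m P.
  by rewrite horner_mx_uconj // !mulmxA mulVmx // mul1mx mulmxKV.
exists [seq T i i | i <- enum 'I_n.+1]; split=> [||p].
- by rewrite size_map size_enum_ord.
- rewrite hE big_map big_enum /= -char_poly_trig // Cayley_Hamilton.
  by rewrite mulmx0 mul0mx.
rewrite hE mxtrace_mulC mulmxA mulmxV // mul1mx big_map big_enum /=.
by apply: eq_bigr => i _; have [_ ->] := horner_mx_trig p Ttrig.
Qed.

Lemma dvdp_big_sum (F : fieldType) (I : eqType) (s : seq I)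
    (f : I -> {poly F}) q :
  {in s, forall i, q %| f i} -> q %| \sum_(i <- s) f i.
Proof.
move=> sq; rewrite big_seq; elim/big_ind: _ => [|p1 p2|i /sq //].
  exact: dvdp0.
exact: dvdp_add.
Qed.

(** D takes the value a^* to order n+1 at every eigenvalue a of A, so D(A) acts
    on the generalized eigenspace of a as the scalar a^*. Hence ad (D(A)) acts
    on the maps from the eigenspace of b to that of a as the scalar
    a^* - b^* = (a - b)^*, and a polynomial E that takes the value c^* to high
    order at every difference c of eigenvalues does the same through ad A: this
    needs that conjugation is additive. Finally tr (A D(A)) is the sum of the
    a a^* over the eigenvalues, which vanishes only if they all do. *)
Lemma conj_replica (C : numClosedFieldType) n (A : 'M[C]_n.+1) :
  exists D E : {poly C},
    (forall V, horner_ad A E V = ad_mx (horner_mx A D) V) /\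
    (\tr (A * horner_mx A D) = 0 -> A ^+ n.+1 = 0).
Proof.
have [r [szr Ar trA]] := mxtrace_horner A.
pose s := undup r; have us : uniq s := undup_uniq r; pose N := n.+1.
have A0 p : {in s, forall a, ('X - a%:P) ^+ N %| p} -> horner_mx A p = 0.
  move=> /(dvdp_prod_XsubC_exp us); have := dvdp_prod_undup r.
  rewrite szr => /dvdp_trans/[apply] /dvdpP[q ->].
  by rewrite rmorphM /= Ar mulr0.
have /choice[p pP] (a : C) :
    exists p, {in s, forall b, ('X - b%:P) ^+ N %| p - (b == a)%:R%:P}.
  exact: poly_jet_interpolation.
(* The spectral projectors of A. *)
pose P a := horner_mx A (p a).
have P1 : \sum_(a <- s) P a = 1.
  apply/eqP; rewrite -subr_eq0 -(rmorph1 (horner_mx A)) -rmorph_sum -rmorphB.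
  apply/eqP/A0 => b bs; have -> : 1 = \sum_(a <- s) (b == a)%:R%:P :> {poly C}.
    rewrite (bigD1_seq b) //= eqxx big1 ?addr0 // => a /negPf.
    by rewrite eq_sym => ->.
  by rewrite -sumrB; apply: dvdp_big_sum => a _; exact: pP.
have aP a : a \in s -> (A - a%:M) ^+ N * P a = 0.
  move=> sa; rewrite -(horner_mx_X A) -(horner_mx_C A) -rmorphB -rmorphXn.
  rewrite -rmorphM; apply: A0 => b bs; have := pP a b bs.
  have [-> _|_] := eqVneq b a; first exact: dvdp_mulr.
  by rewrite subr0; exact: dvdp_mull.
have Pa a : a \in s -> P a * (A - a%:M) ^+ N = 0.
  move=> sa; rewrite -(aP a sa) -(horner_mx_X A) -(horner_mx_C A).
  by rewrite -rmorphB -rmorphXn; apply: comm_horner_mx2.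
pose D := \sum_(a <- s) a^* *: p a.
have DA : horner_mx A D = \sum_(a <- s) a^* *: P a.
  by rewrite /D linear_sum; apply: eq_bigr => a _; rewrite linearZ.
have Da a : a \in r -> D.[a] = a^*.
  rewrite -mem_undup -/s => sa; rewrite horner_sum (bigD1_seq a) //=.
  have pE b : (p b).[a] = (a == b)%:R.
    have /dvdpP[q /(congr1 (fun f => f.[a]))] := pP b a sa.
    rewrite !hornerE subrr expr0n mulr0 => /eqP.
    by rewrite subr_eq0 => /eqP.
  rewrite hornerZ pE eqxx mulr1 big1 ?addr0 // => b /negPf ba.
  by rewrite hornerZ pE eq_sym ba mulr0.
pose d := [seq a - b | a <- s, b <- s].
(* 2 (n+1) bounds the nilpotency order in horner_ad_eq0 for i = j = n+1. *)
have [E EP] := poly_jet_interpolation (@Num.conj C) (N + N) (undup_uniq d).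
exists D, E; split=> [V|].
  have VE : V = \sum_(a <- s) \sum_(b <- s) P a * V * P b.
    under eq_bigr do rewrite -mulr_sumr P1 mulr1.
    by rewrite -mulr_suml P1 mul1r.
  rewrite [in LHS]VE linear_sum /=.
  have -> : ad_mx (horner_mx A D) V
      = \sum_(a <- s) \sum_(b <- s) (a^* - b^*) *: (P a * V * P b).
    rewrite /ad_mx DA.
    have -> : (\sum_(a <- s) a^* *: P a) * V
        = \sum_(a <- s) \sum_(b <- s) a^* *: (P a * V * P b).
      rewrite mulr_suml; apply: eq_bigr => a _.
      by rewrite -scaler_sumr -mulr_sumr P1 mulr1 scalerAl.
    have -> : V * (\sum_(a <- s) a^* *: P a)
        = \sum_(a <- s) \sum_(b <- s) b^* *: (P a * V * P b).
      rewrite exchange_big mulr_sumr; apply: eq_bigr => b _ /=.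
      by rewrite -scaler_sumr -!mulr_suml P1 mul1r scalerAr.
    rewrite -sumrB; apply: eq_bigr => a _; rewrite -sumrB.
    by apply: eq_bigr => b _; rewrite scalerBl.
  apply: eq_big_seq => a sa; rewrite linear_sum /=; apply: eq_big_seq => b sb.
  have /EP/dvdpP[Q] : a - b \in undup d.
    by rewrite mem_undup; apply/allpairsP; exists (a, b).
  move/eqP; rewrite subr_eq => /eqP ->; rewrite horner_adD horner_adC.
  rewrite (@horner_ad_eq0 _ _ _ Q a b N N) ?leqnSn ?add0r ?rmorphB //.
    by rewrite !mulrA aP // !mul0r.
  by rewrite -!mulrA Pa // !mulr0.
rewrite -{1}(horner_mx_X A) -rmorphM trA big_seq.
under eq_bigr => a ra do rewrite hornerM hornerX Da //.
rewrite -big_seq => /eqP; rewrite psumr_eq0 => [/allP r0|a _]; last first.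
  exact: mul_conjC_ge0.
rewrite -[RHS]Ar big_seq (eq_bigr (fun=> 'X)).
  rewrite -big_seq big_const_seq count_predT szr iter_mulr_1.
  by rewrite rmorphXn /= horner_mx_X.
by move=> a /r0; rewrite /= mul_conjC_eq0 => /eqP ->; rewrite subr0.
Qed.

(** * Cartan's criterion: the trace argument *)

Section Cartan.
Variables (R : rcfType) (g : leftLeibnizType R) (m : nat).
Variables (f : {linear g -> 'M[R]_m}) (J : {vspace g}).
Hypothesis fM : forall u v, f (u • v) = f u *m f v - f v *m f u.
Hypothesis trJ : forall u v, u \in J -> \tr (f u *m f v) = 0.

(** With Y = D(f x) as in [conj_replica],
      tr (f (u v) Y) = - tr (f u (ad Y) (f v)) = - tr (f u E(ad (f x)) (f v)),
    and ad (f x) maps the image of f to itself. So the right-hand side is a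
    combination of traces of f u times elements of that image, all 0 for u in J.
    As J is spanned by products, tr (f x Y) = 0, and then f x is nilpotent. *)
Lemma trace_form_nilpotent x : bulv J J = J -> x \in J -> f x ^+ m = 0.
Proof.
case: m f fM trJ => [|n] r rM tr0 JJ xJ; first by apply/matrixP => -[].
pose F u := map_mx (real_complex R) (r u).
have FM u v : F (u • v) = ad_mx (F u) (F v).
  by rewrite /F rM map_mxB !map_mxM.
have FI k v : F (iter k (bul x) v) = iter k (ad_mx (F x)) (F v).
  by elim: k => //= k IHk; rewrite FM IHk.
have [D [E [DE Dnil]]] := conj_replica (F x).
set Y := horner_mx (F x) D in DE Dnil.
have TM u v : u \in J -> \tr (F (u • v) * Y) = 0.
  move=> uJ; rewrite FM.
  have -> : \tr (ad_mx (F u) (F v) * Y) = - \tr (F u * ad_mx Y (F v)).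
    rewrite /ad_mx mulrBl mulrBr !linearB /= opprK [RHS]addrC; congr (_ - _).
      by rewrite mulrA.
    by rewrite -mulrA [LHS]mxtrace_mulC mulrA.
  rewrite -DE /horner_ad mulr_sumr (raddf_sum (@mxtrace _ _)) /=.
  rewrite big1 ?oppr0 // => k _.
  rewrite -scalerAr mxtraceZ -FI -[F u * _]map_mxM trace_map_mx.
  by rewrite tr0 // rmorph0 mulr0.
suff /Dnil Fx0 : \tr (F x * Y) = 0.
  apply: (map_mx_inj (f := real_complex R)).
  by rewrite map_mx0 -Fx0 [LHS]rmorphXn.
move: (xJ); rewrite -{1}JJ => /memv_lspan[s sJ xs].
rewrite (coord_span (X := in_tuple s) xs).
rewrite /F linear_sum map_mx_sum mulr_suml (raddf_sum (@mxtrace _ _)) /=.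
rewrite big1 // => i _.
have [|u [v [uJ vJ ->]]] := sJ (s`_i); first exact: mem_nth.
by rewrite linearZ map_mxZ -scalerAl mxtraceZ [\tr _]TM // mulr0.
Qed.

End Cartan.

(** * Engel's theorem *)

Section Engel.
Variables (K : fieldType) (g : lieType K).
Implicit Types (J M V : {vspace g}) (x : g).

Lemma bul_anti (u v : g) : u • v = - (v • u).
Proof.
apply/eqP; rewrite -addr_eq0; have := bulxx (u + v).
by rewrite linearDl !linearDr !bulxx add0r addr0 => ->.
Qed.

(** A bound on the length of the nonzero products m_1 (m_2 (... v)) with all
    m_i in M, stated through the descending chain of the spans of such products:
    the form in which it contradicts J J = J. *)
Definition acts_nilpotently M := exists N, iter N (bulv M) fullv = 0%VS.

(** Let V_k be spanned by the products of k elements of M. Since x normalizes M,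
    it preserves V_k, and M acts as zero on V_k / V_(k+1); there M + <x> acts
    through the nilpotent x alone, so p factors suffice to pass from V_k to
    V_(k+1), and N p factors in all. *)
Lemma acts_nilpotently_step M x : (forall m, m \in M -> m • x \in M) ->
  (exists p, forall y, iter p (bul x) y = 0) -> acts_nilpotently M ->
  acts_nilpotently (M + <[x]>)%VS.
Proof.
move=> Mx [p xp] [N MN]; set M' := (M + _)%VS.
pose V k := iter k (bulv M) fullv.
have VS k : (V k.+1 <= V k)%VS.
  by elim: k => [|k IHk]; [exact: subvf | exact: bulvS].
have xV k v : v \in V k -> x • v \in V k.
  elim: k v => [|k IHk] v; first by rewrite !memvf.
  rewrite -LmulE memv_preim; move: v; apply/subvP/bulv_subv => u v uM vV.
  rewrite -memv_preim LmulE bul_leibniz memvD ?memv_bulv ?IHk //.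
  by rewrite bul_anti memvN Mx.
have pow k : (iter p (bulv M') (V k) <= V k.+1)%VS.
  pose W j := iter j (fun U => Lmul x @: U)%VS (V k).
  have WV j : (W j <= V k)%VS.
    elim: j => // j /subvP IHj; apply/subvP => _ /memv_imgP[w /IHj wV ->].
    by rewrite LmulE xV.
  have Wp : W p = 0%VS.
    have WE j y : y \in W j -> exists w, y = iter j (bul x) w.
      elim: j y => [|j IHj] y; first by exists y.
      by move=> /memv_imgP[_ /IHj[w ->] ->]; exists w; rewrite LmulE.
    apply/eqP; rewrite -subv0; apply/subvP => y /WE[w ->].
    by rewrite xp mem0v.
  suff le j : (iter j (bulv M') (V k) <= W j + V k.+1)%VS.
    by rewrite (subv_trans (le p)) // Wp add0v.
  elim: j => [|j /subvP IHj]; first exact: addvSl.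
  apply: bulv_subv => y y' /memv_addP[u uM [_ /vlineP[a ->] ->{y}]] /IHj.
  move=> {y'}/memv_addP[w wW [v vV ->]].
  have uwv : u • (w + v) \in V k.+1.
    apply: memv_bulv => //; apply: memvD; first exact: (subvP (WV j)).
    exact: (subvP (VS k)).
  rewrite linearDl linearZl_LR (linearDr _ x) scalerDr addrCA memv_add //.
    by rewrite memvZ // -LmulE memv_img.
  by rewrite memvD ?memvZ ?xV.
exists (N * p)%N; apply/eqP; rewrite -subv0 -MN -/(V N).
have mono k U U' : (U <= U')%VS ->
    (iter k (bulv M') U <= iter k (bulv M') U')%VS.
  by move=> UU'; elim: k => // k IHk; apply: bulvS.
elim: N {MN} => [|k IHk]; first exact: subvf.
by rewrite mulSn iterD (subv_trans (mono _ _ _ IHk)).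
Qed.

(** A maximal subalgebra M of J among those acting nilpotently is J: otherwise
    the last term of the chain J, M J, M (M J), ... not contained in M contains
    an x outside M with M x <= M, and M + <x> is a larger such subalgebra. *)
Theorem engel J : (bulv J J <= J)%VS ->
  (forall x, x \in J -> exists p, forall y, iter p (bul x) y = 0) ->
  acts_nilpotently J.
Proof.
move=> JJ Jnil.
pose P d := `[< exists M, [/\ (M <= J)%VS, (bulv M M <= M)%VS,
                              acts_nilpotently M & \dim M = d] >].
have exP : exists d, P d.
  exists 0%N; apply/asboolP; exists 0%VS; rewrite sub0v dimv0; split=> //.
    by apply: bulv_subv => u v; rewrite !memv0 => /eqP-> _; rewrite linear0l.
  exists 1%N; apply/eqP; rewrite -subv0; apply: bulv_subv => u v.
  by rewrite !memv0 => /eqP-> _; rewrite linear0l.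
have ubP d : P d -> (d <= \dim {:g})%N.
  by move=> /asboolP[M [_ _ _ <-]]; rewrite dimvS ?subvf.
case: (ex_maxnP exP ubP) => d /asboolP[M [MJ MM Mnil <-]] Mmax.
suff JM : (J <= M)%VS by have -> : J = M by apply: subv_anti; rewrite JM.
apply/negPn/negP => JnM.
have [k kM k1M] : exists2 k, ~~ (iter k (bulv M) J <= M)%VS
                           & (iter k.+1 (bulv M) J <= M)%VS.
  have [N MN] := Mnil.
  have : (iter N (bulv M) J <= M)%VS.
    rewrite (@subv_trans _ _ (iter N (bulv M) fullv)) ?MN ?sub0v //.
    by rewrite -MN; elim: N {MN} => [|N IHN]; [exact: subvf | exact: bulvS].
  elim: N {MN} => [|N IHN] JN; first by rewrite JN in JnM.
  by have [/IHN|] := boolP (iter N (bulv M) J <= M)%VS => // ?; exists N.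
have kJ : (iter k (bulv M) J <= J)%VS.
  by elim: k {kM k1M} => //= k IHk; rewrite (subv_trans _ JJ) ?bulvS.
have [x xk xM] := subvPn kM.
have Mx m : m \in M -> m • x \in M.
  by move=> mM; apply: (subvP k1M); rewrite memv_bulv.
have xJ := subvP kJ x xk.
have : (\dim M < \dim (M + <[x]>))%N.
  rewrite ltn_neqAle dimvS ?addvSl // andbT (dimv_leqif_eq (addvSl _ _)).
  apply: contraNneq xM => ->; exact: subvP (addvSr _ _) _ (memv_line x).
rewrite ltnNge => /negP; apply; apply: Mmax; apply/asboolP.
exists (M + <[x]>)%VS; split=> //.
- by rewrite subv_add MJ -memvE.
- rewrite (@subv_trans _ _ M) ?addvSl //; apply: bulv_subv.
  move=> y y' /memv_addP[u uM [_ /vlineP[a ->] ->{y}]].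
  move=> {y'}/memv_addP[v vM [_ /vlineP[b ->] ->]].
  rewrite linearDl !linearDr !linearZl_LR !linearZr_LR /= bulxx !scaler0 addr0.
  rewrite !memvD ?memvZ ?Mx //; first by apply/(subvP MM)/memv_bulv.
  by rewrite bul_anti memvN Mx.
- by apply: acts_nilpotently_step => //; exact: Jnil.
Qed.

Lemma perfect_nilpotent_eq0 J : bulv J J = J -> acts_nilpotently J -> J = 0%VS.
Proof.
move=> JJ [N JN]; apply/eqP; rewrite -subv0 -JN.
by elim: N {JN} => [|N IHN]; [exact: subvf | rewrite -{1}JJ /= bulvS].
Qed.

End Engel.

(** * Left multiplications and the form B *)

Section LeftMultiplication.
Variables (F : fieldType) (g : leftLeibnizType F).
Implicit Types (u v : g) (U : {vspace g}).

Lemma LmulM u v :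
  Lmul (u • v) = (Lmul u \o Lmul v)%VF - (Lmul v \o Lmul u)%VF.
Proof.
apply/lfunP => w; rewrite add_lfunE opp_lfunE !comp_lfunE !LmulE.
exact: bulA.
Qed.

(** [mxof] acts on row vectors and reverses composition; the transpose makes
    [Lmx] a representation. *)
Definition Lmx u : 'M[F]_(\dim {:g}) :=
  (mxof (vbasis {:g}) (vbasis {:g}) (Lmul u))^T.

Fact Lmx_linear : linear Lmx.
Proof. by move=> a u v; rewrite /Lmx !linearP. Qed.
HB.instance Definition _ := GRing.isLinear.Build F g 'M[F]_(\dim {:g}) *:%R
  Lmx Lmx_linear.

Lemma LmxM u v : Lmx (u • v) = Lmx u *m Lmx v - Lmx v *m Lmx u.
Proof.
by rewrite /Lmx LmulM !linearB /= !(mxof_comp _ _ (vbasisP _)) !trmx_mul.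
Qed.

Lemma mxtrace_Lmx u v : \tr (Lmx u *m Lmx v) = B_form u v.
Proof.
by rewrite -trmx_mul mxtrace_tr -(mxof_comp _ _ (vbasisP _)).
Qed.

Lemma Lmx_nilpotent u k : Lmx u ^+ k = 0 -> forall v, iter k (bul u) v = 0.
Proof.
move=> uk v; set b := vbasis {:g}; have bP : basis_of {:g} b := vbasisP _.
have it j : rVof b (iter j (bul u) v) = rVof b v *m (Lmx u ^+ j)^T.
  elim: j => [|j IHj]; first by rewrite trmx1 mulmx1.
  rewrite exprS trmx_mul mulmxA -IHj trmxK mul_mxof rVofK //.
  by rewrite LmulE.
apply/eqP; rewrite -(rVof_eq0 bP) it uk.
by rewrite trmx0 mulmx0.
Qed.

(** A term of least dimension in the decreasing derived series. *)
Lemma derived_stable U : (bulv U U <= U)%VS ->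
  exists n, derived U n.+1 = derived U n.
Proof.
move=> UU; pose P d := `[< exists n, \dim (derived U n) = d >].
have exP : exists d, P d by exists (\dim U); apply/asboolP; exists 0%N.
case: (ex_minnP exP) => d /asboolP[n <-] dmin; exists n; apply/eqP.
have leS k : (derived U k.+1 <= derived U k)%VS.
  by elim: k => // k IHk; apply: bulvS.
rewrite -(dimv_leqif_eq (leS n)) eqn_leq dimvS ?leS //=.
by apply: dmin; apply/asboolP; exists n.+1.
Qed.

Lemma B_bi_invariant : bi_invariant (@B_form F g).
Proof.
have BM u v w : B_form (u • v) w = \tr (Lmx u *m Lmx v *m Lmx w) -
                                   \tr (Lmx v *m Lmx u *m Lmx w).
  by rewrite -mxtrace_Lmx LmxM mulmxBl linearB.
have BMr u v w : B_form u (v • w) = \tr (Lmx u *m Lmx v *m Lmx w) -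
                                   \tr (Lmx u *m Lmx w *m Lmx v).
  by rewrite -mxtrace_Lmx LmxM mulmxBr linearB /= !mulmxA.
have trC u v w : \tr (Lmx u *m Lmx v *m Lmx w) = \tr (Lmx w *m Lmx u *m Lmx v).
  by rewrite mxtrace_mulC mulmxA.
split=> u v w /=; rewrite BM BMr.
- by rewrite (trC v w) addrA subrK subrr.
- by rewrite (trC u w) [_ + _]addrC addrA subrK subrr.
- by rewrite (trC u w).
Qed.

Lemma form_ker_ideal (S : {symmetric g}) :
  bi_invariant S -> idealv (form_ker S).
Proof.
move=> [SL SR SA] x u /mem_form_ker Sx; split; apply/mem_form_ker => w.
  by have /eqP := SL u x w; rewrite Sx addr0 => /eqP.
by rewrite SA Sx.
Qed.

End LeftMultiplication.

(** * Solvability of the kernel of the Killing form *)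

(** The elements of the stable term J = J J of the derived series have nilpotent
    left multiplications by [trace_form_nilpotent], so J acts nilpotently by
    [engel], which is compatible with J J = J only for J = 0. *)
Theorem cartan_solvable (R : rcfType) (h : lieType R) (U : {vspace h}) :
  (bulv U U <= U)%VS -> (forall u v, u \in U -> B_form u v = 0) ->
  solvablev U.
Proof.
move=> UU BU; have [n nS] := derived_stable UU; exists n.
have JU : (derived U n <= U)%VS.
  by elim: n {nS} => //= n IHn; rewrite (subv_trans _ UU) ?bulvS.
apply: perfect_nilpotent_eq0 (nS) _; apply: engel.
  by rewrite [X in (X <= _)%VS]nS.
move=> x xJ; exists (\dim {:h}); apply: Lmx_nilpotent.
apply: (trace_form_nilpotent (@LmxM _ h) _ nS xJ) => u v uJ.
by rewrite mxtrace_Lmx BU // (subvP JU).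
Qed.

(** * The form K as a pullback of a Killing form *)

Lemma lftrace_compC (F : fieldType) (V W : vectType F)
   (f : 'Hom(V, W)) (h : 'Hom(W, V)) :
  lftrace (f \o h)%VF = lftrace (h \o f)%VF.
Proof.
by rewrite /lftrace !(mxof_comp _ _ (vbasisP _)) mxtrace_mulC.
Qed.

Section KillingQuotient.
Variables (F : numFieldType) (g : leftLeibnizType F).
Implicit Types (u v : g).

(** Let s be a linear section of pi. The trace of L_a L_b on g/Leib is the trace
    of L_a L_b s pi on g, that is tr (L_a L_b) - tr (L_a L_b t), where
    t = 1 - s pi projects g onto Leib. On the other hand L_b + R_b has its image
    in Leib, and R_b vanishes on Leib, so
      tr (L_a (L_b + R_b)) = tr ((L_b + R_b) L_a t) = tr (L_b L_a t). *)
Lemma K_form_killing u v : K_form u v = killing_form (lie_proj u) (lie_proj v).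
Proof.
pose p : 'Hom(g, lie_quot g) := linfun (@lie_proj F g).
have pE w : p w = lie_proj w by rewrite lfunE.
pose s := (p^-1)%VF.
have ps : (p \o s)%VF = \1%VF.
  apply/lfunP => x; rewrite comp_lfunE id_lfunE limg_lfunVK //.
  by rewrite -[x]lie_projK -pE memv_img ?memvf.
pose t := \1%VF - (s \o p)%VF.
have tLeib w : t w \in Leib g.
  rewrite -lie_proj_eq0 -pE add_lfunE opp_lfunE id_lfunE comp_lfunE linearB /=.
  by rewrite -(comp_lfunE p s) ps id_lfunE subrr.
have t_id w : w \in Leib g -> t w = w.
  rewrite -lie_proj_eq0 -pE => /eqP pw.
  by rewrite add_lfunE opp_lfunE id_lfunE comp_lfunE pw linear0 subr0.
have pL w : (p \o Lmul w)%VF = (Lmul (lie_proj w) \o p)%VF.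
  by apply/lfunP => x; rewrite !comp_lfunE !LmulE !pE lie_projM.
have trQ (a b : g) : killing_form (lie_proj a) (lie_proj b) =
    lftrace (Lmul a \o Lmul b \o (s \o p))%VF.
  rewrite /killing_form comp_lfunA [RHS]lftrace_compC !comp_lfunA pL.
  rewrite -(comp_lfunA _ p) pL comp_lfunA -(comp_lfunA _ p) ps.
  by rewrite comp_lfun1r.
have trLR (a b : g) : lftrace (Lmul a \o Rmul b)%VF =
    lftrace (Lmul b \o Lmul a \o t)%VF - lftrace (Lmul a \o Lmul b)%VF.
  pose S := Lmul b + Rmul b.
  have tS : (t \o S)%VF = S.
    apply/lfunP => w; rewrite comp_lfunE t_id //.
    by rewrite add_lfunE LmulE RmulE memv_Leib.
  have St : (S \o (Lmul a \o t) = Lmul b \o (Lmul a \o t))%VF.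
    apply/lfunP => w; rewrite !comp_lfunE add_lfunE RmulE bul_Leib ?addr0 //.
    by rewrite LmulE; case: (@Leib_ideal _ g (t w) a).
  have -> : Rmul b = S - Lmul b by rewrite /S addrAC subrr add0r.
  rewrite comp_lfunDr comp_lfunNr linearB /=; congr (_ - _).
  by rewrite -{1}tS comp_lfunA lftraceC St comp_lfunA.
have tr1 (a b : g) :
    lftrace (Lmul a \o Lmul b)%VF - lftrace (Lmul a \o Lmul b \o t)%VF
    = killing_form (lie_proj a) (lie_proj b).
  rewrite trQ /t comp_lfunDr comp_lfunNr comp_lfun1r linearB /=.
  by rewrite opprB addrC subrK.
have kC (a b : g) : killing_form (lie_proj a) (lie_proj b) =
    killing_form (lie_proj b) (lie_proj a) by exact: lftraceC.
have trLRE (a b : g) : lftrace (Lmul a \o Rmul b)%VF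
    = - killing_form (lie_proj a) (lie_proj b).
  by rewrite trLR kC -tr1 opprB; congr (_ - _); exact: lftraceC.
rewrite /K_form !trLRE (kC v u).
by field.
Qed.

Lemma K_bi_invariant : bi_invariant (@K_form F g).
Proof.
have [BL BR BA] := @B_bi_invariant F (lie_quot g).
split=> u v w; rewrite /= !K_form_killing !lie_projM.
- exact: BL.
- exact: BR.
- exact: BA.
Qed.

End KillingQuotient.

(** pi maps ker K to the kernel of the Killing form of g/Leib, which is
    solvable; so some derived term of ker K lies in Leib, and Leib Leib = 0. *)
Lemma solvable_ker_K (R : rcfType) (g : leftLeibnizType R) :
  solvablev (form_ker (@K_form R g)).
Proof.
pose U := form_ker (@B_form R (lie_quot g)).
have UU : (bulv U U <= U)%VS.
  apply: bulv_subv => x y xU yU.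
  exact: (form_ker_ideal (@B_bi_invariant _ (lie_quot g)) x yU).1.
have [|n Un] := cartan_solvable UU; first by move=> u v /mem_form_ker; apply.
pose I := form_ker (@K_form R g).
have proj k x : x \in derived I k -> lie_proj x \in derived U k.
  elim: k x => [|k IHk] x /=.
    move=> /mem_form_ker Kx; apply/mem_form_ker => y; rewrite -[y]lie_projK.
    by rewrite -[LHS]K_form_killing Kx.
  pose p : 'Hom(g, lie_quot g) := linfun (@lie_proj R g).
  have pE w : p w = lie_proj w by rewrite lfunE.
  rewrite -pE memv_preim; move: x; apply/subvP/bulv_subv => x y xI yI.
  by rewrite -memv_preim pE lie_projM memv_bulv ?IHk.
have IL : (derived I n <= Leib g)%VS.
  by apply/subvP => x /proj; rewrite Un memv0 lie_proj_eq0.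
exists n.+1; apply/eqP; rewrite -subv0 /=.
by apply: bulv_subv => x y /(subvP IL) xL _; rewrite bul_Leib // mem0v.
Qed.

Theorem proposition2p2 (R : realType) (g : leftLeibnizType R) :
  [/\ bi_invariant (@B_form R g) /\ bi_invariant (@K_form R g),
      (Leib g <= form_ker (@B_form R g))%VS /\
      (Leib g <= form_ker (@K_form R g))%VS,
      (forall u v : g,
         K_form u v = killing_form (lie_proj u) (lie_proj v)),
      idealv (form_ker (@K_form R g)) /\ solvablev (form_ker (@K_form R g))
    & (form_ker (@K_form R g) <= radical g)%VS ].
Proof.
have idK := form_ker_ideal (@K_bi_invariant R g).
have solK := @solvable_ker_K R g.
split=> //.
- by split; [exact: B_bi_invariant | exact: K_bi_invariant].
- split; apply/subvP => x xL; apply/mem_form_ker => y.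
    have x0 : Lmul x = 0.
      by apply/lfunP => z; rewrite LmulE zero_lfunE bul_Leib.
    by rewrite /= /B_form x0 comp_lfun0l linear0.
  have /eqP x0 : lie_proj x == 0 by rewrite lie_proj_eq0.
  rewrite /= K_form_killing x0.
  by rewrite /killing_form linear0 comp_lfun0l linear0.
- by move=> u v; exact: K_form_killing.
- by have [_ _] := radicalP g; apply.
Qed.
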